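(* Let $\Bbbk$ be a field with $\mathrm{char}(\Bbbk)\ne 2$, let $H_4$ be Sweedler's Hopf algebra and let $A=Cl(\alpha,\beta,\gamma)$ with its canonical $H_4$-comodule algebra structure. Let $\mathfrak{T}$ be a total integral on $(H_4,\psi)$, with parameters $\mathbf{A},\mathbf{B},\mathbf{C},\mathbf{D},\mathbf{E},\mathbf{Z}\in\Bbbk$ (as described in the context). Then $\mathfrak{T}$ satisfies the h-property if and only if one of the following holds: 1) $\mathbf{A}=1$, $\mathbf{B}=0$, $\mathbf{C}=0$, $\mathbf{D}=1$, $\mathbf{E}=0$, $\mathbf{Z}=0$ (i.e. $\mathfrak{T}(h)=1_A\otimes S^{-1}(h)$ for all $h$); 2) $\mathbf{A}=-1$, $\mathbf{B}=0$, $\mathbf{C}=0$, $\mathbf{D}=1$, $\mathbf{E}=0$, $\mathbf{Z}=0$; 3) $\gamma^2-4\alpha\beta=0$ and $\alpha\in(\Bbbk^\times)^2$, and $\mathbf{A}=0$, $\alpha\mathbf{B}^2=1$, $\mathbf{C}=-\frac{\gamma}{2\alpha}$, $\mathbf{D}=0$, $\mathbf{E}=0$, $\mathbf{Z}=0$.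
   Context: Everything is over a field $\Bbbk$ with $\mathrm{char}(\Bbbk)\ne2$; $\otimes=\otimes_\Bbbk$; Sweedler notation with suppressed summation is used; $(\Bbbk^\times)^2$ is the set of squares of nonzero elements of $\Bbbk$. $H_4=E(1)$ is the 4-dimensional Hopf algebra generated by $g,x$ with $g^2=1$, $x^2=0$, $gx=-xg$, $\Delta(g)=g\otimes g$, $\varepsilon(g)=1$, $S(g)=g$, $\Delta(x)=x\otimes g+1\otimes x$, $\varepsilon(x)=0$, $S(x)=gx$. $Cl(\alpha,\beta,\gamma)$, for $\alpha,\beta,\gamma\in\Bbbk$, is the 4-dimensional unital associative algebra generated by $G,X$ with $G^2=\alpha$, $X^2=\beta$, $GX+XG=\gamma$. Its canonical $H_4$-comodule algebra structure is the algebra map $\rho$ with $\rho(G)=G\otimes g$, $\rho(X)=X\otimes g+1_A\otimes x$. For a Hopf algebra $H$ with bijective antipode and right $H$-comodule algebra $(A,\rho)$, $\rho(a)=a_0\otimes a_1$, the cowreath $(A\otimes H^{\mathrm{op}},H,\psi)$ has $\psi(h\otimes a\otimes l)=a_0\otimes l_1\otimes l_2ha_1$. Products written without symbol in $A\otimes H$ use the ordinary multiplications of $A$ and $H$. An integral on $(H,\psi)$ is a $\Bbbk$-linear map $\mathfrak{T}:H\to A\otimes H^{\mathrm{op}}$, $\mathfrak{T}(h)=\mathfrak{T}^A(h)\otimes\mathfrak{T}^H(h)$, such that for all $a\in A,h\in H$: $$\mathfrak{T}^A(h_2)_0\otimes \mathfrak{T}^H(h_2)_1\otimes \mathfrak{T}^H(h_2)_2h_1\mathfrak{T}^A(h_2)_1=\mathfrak{T}(h)\otimes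 1_H,$$ $$(a_0\otimes 1_H)\mathfrak{T}(S^{-1}(a_2)ha_1)(1_A\otimes S^{-1}(a_3))=(1_A\otimes S^{-1}(a_1))\mathfrak{T}(h)(a_0\otimes 1_H).$$ It is total if $\mathfrak{T}(1_H)=1_A\otimes 1_H$. A total integral satisfies the h-property if $(\mathrm{Id}_A\otimes\varepsilon)(\mathfrak{T}(h)\mathfrak{T}(h'))=(\mathrm{Id}_A\otimes\varepsilon)(\mathfrak{T}(h'h))$ for all $h,h'\in H$. The total integrals on $(H_4,\psi)$ are exactly the linear maps with $\mathfrak{T}(1_{H_4})=1_A\otimes 1_{H_4}$ and $$\begin{aligned} \mathfrak{T}(g)&=\mathbf{A}(1_A\otimes g)+\mathbf{B}(G\otimes 1_{H_4})+\mathbf{Z}(GX\otimes g)-\mathbf{Z}(G\otimes gx),\\ \mathfrak{T}(x)&=-\tfrac{\gamma}{2}\mathbf{B}(1_A\otimes 1_{H_4})+\mathbf{B}(GX\otimes 1_{H_4})+\beta\mathbf{Z}(G\otimes g)-\mathbf{A}(1_A\otimes gx)-\mathbf{Z}(GX\otimes gx),\\ \mathfrak{T}(gx)&=\mathbf{D}(1_A\otimes x)+\tfrac{\gamma}{2}\mathbf{E}(1_A\otimes g)-\mathbf{C}(G\otimes 1_{H_4})+(\mathbf{D}-1)(X\otimes 1_{H_4})-\mathbf{E}(GX\otimes g)+\mathbf{E}(G\otimes gx), \end{aligned}$$ with $\mathbf{A},\mathbf{B},\mathbf{C},\mathbf{D},\mathbf{E},\mathbf{Z}\in\Bbbk$ satisfying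 $\mathbf{Z}\alpha=\mathbf{Z}\gamma=0$, $(\mathbf{D}-1)\gamma-2\mathbf{C}\alpha=0$, $2(\mathbf{D}-1)\beta-\mathbf{C}\gamma=0$. *)

(* Defs.v *)
From HB Require Import structures.
From mathcomp Require Import all_boot all_order all_algebra falgebra.
From mathcomp Require Import ring.

Set Implicit Arguments.
Unset Strict Implicit.
Unset Printing Implicit Defensive.

Import GRing.Theory.
Local Open Scope ring_scope.

(** [tensor V W] consists of the coordinate matrices in the tensor product of the
  bases [vbasis {:V}] and [vbasis {:W}].  [sw t (fun v w => f v w)] is the image
  of [t] under the linear map induced by the bilinear [f]; it renders Sweedler
  notation: [sw (comul h) (fun h1 h2 => f h1 h2)] stands for f(h_1, h_2).
  The triple product U (x) V (x) W is associated to the left.  *)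

Definition tensor (k : fieldType) (V W : vectType k) : vectType k :=
  'M[k]_(\dim {:V}, \dim {:W}).

Definition tens (k : fieldType) (V W : vectType k) (v : V) (w : W) :
    tensor V W :=
  \matrix_(i, j) (coord (vbasis {:V}) i v * coord (vbasis {:W}) j w).

Notation "v ⊗ w" := (tens v w) (at level 40, left associativity) : ring_scope.

Definition sw (k : fieldType) (V W : vectType k) (U : lmodType k)
    (t : tensor V W) (f : V -> W -> U) : U :=
  \sum_i \sum_j (t : 'M[k]_(_, _)) i j *: f (vbasis {:V})`_i (vbasis {:W})`_j.

Definition tmul (k : fieldType) (A B : falgType k) (s t : tensor A B) :
    tensor A B :=
  sw s (fun a b => sw t (fun a' b' => (a * a') ⊗ (b * b'))).

Section TensorTheory.
Variable k : fieldType.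
Implicit Types (V W : vectType k) (U : lmodType k) (A B : falgType k).

Lemma coord_vbasisE V (v : V) :
  v = \sum_i coord (vbasis {:V}) i v *: (vbasis {:V})`_i.
Proof. exact: (coord_vbasis (memvf v)). Qed.

Lemma tensDl V W (v v' : V) (w : W) : (v + v') ⊗ w = v ⊗ w + v' ⊗ w.
Proof. by apply/matrixP => i j; rewrite !mxE linearD mulrDl. Qed.

Lemma tensDr V W (v : V) (w w' : W) : v ⊗ (w + w') = v ⊗ w + v ⊗ w'.
Proof. by apply/matrixP => i j; rewrite !mxE linearD mulrDr. Qed.

Lemma tensZl V W c (v : V) (w : W) : (c *: v) ⊗ w = c *: (v ⊗ w).
Proof. by apply/matrixP => i j; rewrite !mxE linearZ mulrA. Qed.

Lemma tensZr V W c (v : V) (w : W) : v ⊗ (c *: w) = c *: (v ⊗ w).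
Proof. by apply/matrixP => i j; rewrite !mxE linearZ mulrCA. Qed.

Lemma swD V W U (s t : tensor V W) (f : V -> W -> U) :
  sw (s + t) f = sw s f + sw t f.
Proof.
rewrite /sw -big_split; apply: eq_bigr => i _.
by rewrite -big_split; apply: eq_bigr => j _; rewrite mxE scalerDl.
Qed.

Lemma swZ V W U c (t : tensor V W) (f : V -> W -> U) :
  sw (c *: t) f = c *: sw t f.
Proof.
rewrite /sw scaler_sumr; apply: eq_bigr => i _.
by rewrite scaler_sumr; apply: eq_bigr => j _; rewrite mxE scalerA.
Qed.

Lemma eq_sw V W U (t : tensor V W) (f f' : V -> W -> U) :
  (forall v w, f v w = f' v w) -> sw t f = sw t f'.
Proof.
by move=> ff'; apply: eq_bigr => i _; apply: eq_bigr => j _; rewrite ff'.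
Qed.

Lemma linear_fun0 (V U : lmodType k) (f : V -> U) : linear f -> f 0 = 0.
Proof.
by move=> fl; have := fl (-1) 0 0; rewrite scaler0 addr0 scaleN1r addNr.
Qed.

Lemma linear_fun_sum (V U : lmodType k) (f : V -> U) n (c : 'I_n -> k)
    (F : 'I_n -> V) :
  linear f -> f (\sum_i c i *: F i) = \sum_i c i *: f (F i).
Proof.
move=> fl; elim: n c F => [|n IH] c F.
  by rewrite !big_ord0 linear_fun0.
by rewrite !big_ord_recl fl IH.
Qed.

Lemma sw_tens V W U (f : V -> W -> U) v w :
    (forall w, linear (f^~ w)) -> (forall v, linear (f v)) ->
  sw (v ⊗ w) f = f v w.
Proof.
move=> fl fr.
rewrite [in RHS](coord_vbasisE v) (linear_fun_sum _ _ (fl w)).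
apply: eq_bigr => i _.
rewrite [in RHS](coord_vbasisE w) (linear_fun_sum _ _ (fr _)) scaler_sumr.
by apply: eq_bigr => j _; rewrite mxE scalerA.
Qed.

Lemma sw_linear V W (X U : lmodType k) (t : tensor V W) (f : X -> V -> W -> U) :
  (forall v w, linear (fun x => f x v w)) -> linear (fun x => sw t (f x)).
Proof.
move=> fl c x y; rewrite /sw scaler_sumr -big_split; apply: eq_bigr => i _.
rewrite scaler_sumr -big_split; apply: eq_bigr => j _.
by rewrite /= fl scalerDr !scalerA mulrC.
Qed.

Lemma tmul_tens A B (a a' : A) (b b' : B) :
  tmul (a ⊗ b) (a' ⊗ b') = (a * a') ⊗ (b * b').
Proof.
rewrite /tmul sw_tens.
- rewrite sw_tens // => w c u v.
  + by rewrite mulrDr -scalerAr tensDl tensZl.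
  + by rewrite mulrDr -scalerAr tensDr tensZr.
- move=> w; apply: sw_linear => u v c x y.
  by rewrite mulrDl -scalerAl tensDl tensZl.
- move=> w; apply: sw_linear => u v c x y.
  by rewrite mulrDl -scalerAl tensDr tensZr.
Qed.

Lemma tmul_linearl A B (t : tensor A B) : linear (fun s => tmul s t).
Proof. by move=> c s s'; rewrite /tmul swD swZ. Qed.

Lemma tmul_linearr A B (s : tensor A B) : linear (tmul s).
Proof. by apply: sw_linear => a b c t t'; rewrite swD swZ. Qed.

End TensorTheory.

(** The antipode is required to be bijective. *)
Record hopfAlgebra (k : fieldType) := HopfAlgebra {
  hopf_alg :> falgType k;
  comul : {linear hopf_alg -> tensor hopf_alg hopf_alg};
  counit : {linear hopf_alg -> k^o};
  antipode : {linear hopf_alg -> hopf_alg};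
  antipode_inv : {linear hopf_alg -> hopf_alg};
  comulA : forall h,
    sw (comul h) (fun h1 h2 => sw (comul h1) (fun a b => a ⊗ b ⊗ h2)) =
    sw (comul h) (fun h1 h2 => sw (comul h2) (fun a b => h1 ⊗ a ⊗ b));
  counitl : forall h, sw (comul h) (fun h1 h2 => counit h1 *: h2) = h;
  counitr : forall h, sw (comul h) (fun h1 h2 => counit h2 *: h1) = h;
  comul1 : comul 1 = 1 ⊗ 1;
  comulM : forall h h', comul (h * h') = tmul (comul h) (comul h');
  counit1 : counit 1 = 1;
  counitM : forall h h', counit (h * h') = counit h * counit h';
  antipodel : forall h,
    sw (comul h) (fun h1 h2 => antipode h1 * h2) = counit h *: 1;
  antipoder : forall h,
    sw (comul h) (fun h1 h2 => h1 * antipode h2) = counit h *: 1;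
  antipodeK : cancel antipode antipode_inv;
  antipode_invK : cancel antipode_inv antipode
}.

Record comoduleAlgebra (k : fieldType) (H : hopfAlgebra k) := ComoduleAlgebra {
  comod_alg :> falgType k;
  coact : {linear comod_alg -> tensor comod_alg H};
  coactA : forall a,
    sw (coact a) (fun a0 a1 => sw (coact a0) (fun b c => b ⊗ c ⊗ a1)) =
    sw (coact a) (fun a0 a1 => sw (comul H a1) (fun b c => a0 ⊗ b ⊗ c));
  coact_counit : forall a, sw (coact a) (fun a0 a1 => counit H a1 *: a0) = a;
  coact1 : coact 1 = 1 ⊗ 1;
  coactM : forall a b, coact (a * b) = tmul (coact a) (coact b)
}.

Section Integrals.
Variables (k : fieldType) (H : hopfAlgebra k) (A : comoduleAlgebra H).

(** The cowreath map ψ(h ⊗ a ⊗ l) = a_0 ⊗ l_1 ⊗ l_2 h a_1 *)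
Definition psi (h : H) (a : A) (l : H) : tensor (tensor A H) H :=
  sw (coact A a) (fun a0 a1 => sw (comul H l) (fun l1 l2 =>
    a0 ⊗ l1 ⊗ (l2 * h * a1))).

(** [sw_coact3 a f] stands for f(a_0, a_1, a_2, a_3). *)
Definition sw_coact3 (U : lmodType k) (a : A) (f : A -> H -> H -> H -> U) : U :=
  sw (coact A a) (fun a0 b => sw (comul H b) (fun a1 c => sw (comul H c) (fun a2 a3 =>
    f a0 a1 a2 a3))).

(** All products in A ⊗ H, including those of the h-property, are
    componentwise, with the multiplication of H rather than that of H^op. *)
Definition is_integral (T : {linear H -> tensor A H}) : Prop :=
  (forall h : H,
     sw (comul H h) (fun h1 h2 => sw (T h2) (fun a l => psi h1 a l)) =
     T h ⊗ (1 : H)) /\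
  (forall (a : A) (h : H),
     sw_coact3 a (fun a0 a1 a2 a3 =>
       tmul (tmul (a0 ⊗ 1) (T (antipode_inv H a2 * h * a1)))
            (1 ⊗ antipode_inv H a3)) =
     sw (coact A a) (fun a0 a1 =>
       tmul (tmul (1 ⊗ antipode_inv H a1) (T h)) (a0 ⊗ 1))).

Definition is_total_integral (T : {linear H -> tensor A H}) : Prop :=
  is_integral T /\ T 1 = 1 ⊗ 1.

(** Id_A ⊗ ε *)
Definition id_counit (t : tensor A H) : A :=
  sw t (fun a h => counit H h *: a).

Definition h_property (T : {linear H -> tensor A H}) : Prop :=
  forall h h' : H, id_counit (tmul (T h) (T h')) = id_counit (T (h' * h)).

End Integrals.

(** [cl a b c d] is a + b G + c X + d GX; the multiplication table follows from
    G^2 = α, X^2 = β and XG = γ - GX. *)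
Record Cl (k : fieldType) (al be ga : k) :=
  ClElt { cl_1 : k; cl_G : k; cl_X : k; cl_GX : k }.

Section Clifford.
Variables (k : fieldType) (al be ga : k).
Notation C := (Cl al be ga).

Definition cl (a b c d : k) : C := ClElt al be ga a b c d.

Definition cl_coords (u : C) : k * k * k * k :=
  (cl_1 u, cl_G u, cl_X u, cl_GX u).

Definition cl_of_coords (p : k * k * k * k) : C :=
  let: (a, b, c, d) := p in cl a b c d.

Lemma cl_coordsK : cancel cl_coords cl_of_coords. Proof. by case. Qed.

HB.instance Definition _ := Choice.copy C (can_type cl_coordsK).

Definition cl_add (u v : C) : C :=
  cl (cl_1 u + cl_1 v) (cl_G u + cl_G v) (cl_X u + cl_X v) (cl_GX u + cl_GX v).
Definition cl_opp (u : C) : C :=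
  cl (- cl_1 u) (- cl_G u) (- cl_X u) (- cl_GX u).
Definition cl_scale (e : k) (u : C) : C :=
  cl (e * cl_1 u) (e * cl_G u) (e * cl_X u) (e * cl_GX u).

Lemma cl_addA : associative cl_add.
Proof. by move=> u v w; rewrite /cl_add /= !addrA. Qed.
Lemma cl_addC : commutative cl_add.
Proof. by move=> u v; congr cl; rewrite addrC. Qed.
Lemma cl_add0 : left_id (cl 0 0 0 0) cl_add.
Proof. by case=> *; rewrite /cl_add /= !add0r. Qed.
Lemma cl_addN : left_inverse (cl 0 0 0 0) cl_opp cl_add.
Proof. by case=> *; rewrite /cl_add /= !addNr. Qed.

HB.instance Definition _ := GRing.isZmodule.Build C
  cl_addA cl_addC cl_add0 cl_addN.

Lemma cl_scaleA a b u : cl_scale a (cl_scale b u) = cl_scale (a * b) u.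
Proof. by rewrite /cl_scale /= !mulrA. Qed.
Lemma cl_scale1 : left_id 1 cl_scale.
Proof. by case=> *; rewrite /cl_scale /= !mul1r. Qed.
Lemma cl_scaleDr : right_distributive cl_scale +%R.
Proof. by move=> e u v; congr cl; rewrite mulrDr. Qed.
Lemma cl_scaleDl u : {morph cl_scale^~ u : a b / a + b}.
Proof. by move=> a b; congr cl; rewrite mulrDl. Qed.

HB.instance Definition _ := GRing.Zmodule_isLmodule.Build k C
  cl_scaleA cl_scale1 cl_scaleDr cl_scaleDl.

Fact cl_vect_axiom : Vector.axiom 4 C.
Proof.
pose f (u : C) : 'rV[k]_4 := \row_i nth 0 [:: cl_1 u; cl_G u; cl_X u; cl_GX u] i.
exists f.
  by move=> e u v; apply/rowP => -[[|[|[|[|]]]] i4]; rewrite ?mxE.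
exists (fun r : 'rV[k]_4 => cl (r 0 0) (r 0 1) (r 0 2) (r 0 3)) => [[a b c d] | r].
  by rewrite !mxE.
by apply/rowP => -[[|[|[|[|]]]] i4] //; rewrite mxE /=; congr (r 0 _); apply/val_inj.
Qed.

HB.instance Definition _ := Lmodule_hasFinDim.Build k C cl_vect_axiom.

Definition cl_one : C := cl 1 0 0 0.

Definition cl_mul (u v : C) : C :=
  let: ClElt a b c d := u in let: ClElt a' b' c' d' := v in
  cl (a * a' + al * b * b' + be * c * c' + ga * c * b' - al * be * d * d')
     (a * b' + b * a' + ga * d * b' - be * c * d' + be * d * c')
     (a * c' + c * a' + al * b * d' - al * d * b' + ga * c * d')
     (a * d' + d * a' + b * c' - c * b' + ga * d * d').

Lemma cl_mulA : associative cl_mul.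
Proof.
move=> [a b c d] [a1 b1 c1 d1] [a2 b2 c2 d2].
by rewrite /cl_mul /cl; congr ClElt; ring.
Qed.

Lemma cl_mul1 : left_id cl_one cl_mul.
Proof. by move=> [a b c d]; rewrite /= /cl; congr ClElt; ring. Qed.

Lemma cl_mulr1 : right_id cl_one cl_mul.
Proof. by move=> [a b c d]; rewrite /= /cl; congr ClElt; ring. Qed.

Lemma clD a b c d a' b' c' d' :
  cl a b c d + cl a' b' c' d' = cl (a + a') (b + b') (c + c') (d + d').
Proof. by []. Qed.

Lemma clZ e a b c d : e *: cl a b c d = cl (e * a) (e * b) (e * c) (e * d).
Proof. by []. Qed.

Lemma cl_mulDl : left_distributive cl_mul +%R.
Proof.
move=> [a b c d] [a1 b1 c1 d1] [a2 b2 c2 d2].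
by rewrite clD /cl_mul /cl /= clD /cl; congr ClElt; ring.
Qed.

Lemma cl_mulDr : right_distributive cl_mul +%R.
Proof.
move=> [a b c d] [a1 b1 c1 d1] [a2 b2 c2 d2].
by rewrite clD /cl_mul /cl /= clD /cl; congr ClElt; ring.
Qed.

Lemma cl_one_neq0 : cl_one != 0.
Proof. by apply/eqP => -[/eqP]; rewrite oner_eq0. Qed.

HB.instance Definition _ := GRing.Zmodule_isNzRing.Build C
  cl_mulA cl_mul1 cl_mulr1 cl_mulDl cl_mulDr cl_one_neq0.

Lemma clM a b c d a' b' c' d' : cl a b c d * cl a' b' c' d' =
  cl (a * a' + al * b * b' + be * c * c' + ga * c * b' - al * be * d * d')
     (a * b' + b * a' + ga * d * b' - be * c * d' + be * d * c')
     (a * c' + c * a' + al * b * d' - al * d * b' + ga * c * d')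
     (a * d' + d * a' + b * c' - c * b' + ga * d * d').
Proof. by []. Qed.

Fact cl_scalerAl (e : k) (u v : C) : e *: (u * v) = (e *: u) * v.
Proof.
move: u v => [a b c d] [a1 b1 c1 d1].
by rewrite -!/(cl _ _ _ _) !(clM, clZ) /cl /=; congr ClElt; ring.
Qed.

HB.instance Definition _ := GRing.Lmodule_isLalgebra.Build k C cl_scalerAl.

Fact cl_scalerAr (e : k) (u v : C) : e *: (u * v) = u * (e *: v).
Proof.
move: u v => [a b c d] [a1 b1 c1 d1].
by rewrite -!/(cl _ _ _ _) !(clM, clZ) /cl /=; congr ClElt; ring.
Qed.

HB.instance Definition _ := GRing.Lalgebra_isAlgebra.Build k C cl_scalerAr.
HB.instance Definition _ := Algebra_isFalgebra.Build k C.

Definition clG : C := cl 0 1 0 0.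
Definition clX : C := cl 0 0 1 0.

Lemma cl1E : (1 : C) = cl 1 0 0 0. Proof. by []. Qed.

Lemma clGG : clG * clG = al%:A.
Proof. by rewrite clM cl1E clZ /cl /=; congr ClElt; ring. Qed.

Lemma clXX : clX * clX = be%:A.
Proof. by rewrite clM cl1E clZ /cl /=; congr ClElt; ring. Qed.

Lemma clGX_XG : clG * clX + clX * clG = ga%:A.
Proof. by rewrite !clM clD cl1E clZ /cl /=; congr ClElt; ring. Qed.

Lemma clGXE : clG * clX = cl 0 0 0 1.
Proof. by rewrite clM /cl /=; congr ClElt; ring. Qed.

Lemma clE a b c d :
  cl a b c d = a *: 1 + b *: clG + c *: clX + d *: (clG * clX).
Proof.
by rewrite clGXE cl1E !clZ !clD /cl /=; congr ClElt; ring.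
Qed.

Lemma cl_ext (u v : C) : cl_1 u = cl_1 v -> cl_G u = cl_G v ->
  cl_X u = cl_X v -> cl_GX u = cl_GX v -> u = v.
Proof. by case: u v => a b c d [a' b' c' d'] /= -> -> -> ->. Qed.

Section Lin.
Variables (V : lmodType k) (v0 v1 v2 v3 : V).

(** The linear map with 1 ↦ v0, G ↦ v1, X ↦ v2, GX ↦ v3. *)
Definition cl_lin (u : C) : V :=
  cl_1 u *: v0 + cl_G u *: v1 + cl_X u *: v2 + cl_GX u *: v3.

Fact cl_lin_linear : linear cl_lin.
Proof.
move=> e u v; rewrite /cl_lin /= !scalerDl -!scalerA !scalerDr.
by do 3![rewrite [RHS]addrACA; congr (_ + _)].
Qed.

HB.instance Definition _ := GRing.isLinear.Build k C V *:%R cl_lin cl_lin_linear.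
End Lin.

Section Universal.
Variables (B : algType k) (G X : B).
Hypotheses (GG : G * G = al%:A) (XX : X * X = be%:A).
Hypothesis GX_XG : G * X + X * G = ga%:A.

Let f : {linear C -> B} := cl_lin 1 G X (G * X).

Let f_G u : f (clG * u) = G * f u.
Proof.
have -> : clG * u = cl (al * cl_G u) (cl_1 u) (al * cl_GX u) (cl_X u).
  by case: u => a b c d; rewrite clM /=; congr ClElt; ring.
rewrite /= /cl_lin /= !mulrDr -!scalerAr mulr1 mulrA GG -scalerAl mul1r.
rewrite ![_ *: (al *: _)]scalerA !(mulrC al).
by rewrite [_ *: 1 + _]addrC -!addrA; congr (_ + (_ + _)); rewrite addrC.
Qed.

Let f_X u : f (clX * u) = X * f u.
Proof.
have -> : clX * u = cl (ga * cl_G u + be * cl_X u) (- (be * cl_GX u))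
                       (cl_1 u + ga * cl_GX u) (- cl_G u).
  by case: u => a b c d; rewrite clM /=; congr ClElt; ring.
have XG : X * G = ga%:A - G * X by rewrite -GX_XG addrAC subrr add0r.
rewrite /= /cl_lin /= !mulrDr -!scalerAr mulr1 mulrA XG XX mulrBl -mulrA XX.
rewrite -!scalerAl -scalerAr mul1r mulr1 !scalerBr !scalerDl !scaleNr !scalerA.
rewrite !(mulrC ga) !(mulrC be).
set p := _ *: 1; set q := _ *: 1; set r := _ *: G; set s := _ *: X.
set t := _ *: X; set w := _ *: (G * X).
by rewrite [RHS](AC (1*2*1*2) (2*4*6*(1*5)*3)).
Qed.

Let f_1 : f 1 = 1.
Proof. by rewrite /= /cl_lin /= scale1r !scale0r !addr0. Qed.

Let f_M : {morph f : u v / u * v}.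
Proof.
move=> u v; transitivity (cl_1 u *: f v + cl_G u *: (G * f v) +
    cl_X u *: (X * f v) + cl_GX u *: (G * (X * f v))).
  rewrite -!(f_G, f_X) -!linearZ -!linearD; congr (f _).
  have {1}-> : u = cl_1 u *: 1 + cl_G u *: clG + cl_X u *: clX +
                   cl_GX u *: (clG * clX) by rewrite -clE; case: u.
  by rewrite !mulrDl -!scalerAl mul1r mulrA.
have -> : f u = cl_1 u *: 1 + cl_G u *: G + cl_X u *: X + cl_GX u *: (G * X).
  by [].
by rewrite !mulrDl -!scalerAl mul1r mulrA.
Qed.

(** Cl(α,β,γ) is presented by generators and relations. *)
Lemma cl_universal :
  exists2 f : {lrmorphism C -> B}, f clG = G /\ f clX = X &
  forall f' : {lrmorphism C -> B}, f' clG = G -> f' clX = X -> f' =1 f.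
Proof.
have fm : GRing.monoid_morphism (cl_lin 1 G X (G * X)) by split; [exact: f_1 | exact: f_M].
pose F : {lrmorphism C -> B} :=
  HB.pack (cl_lin 1 G X (G * X))
    (GRing.isLinear.Build k C B *:%R _ (cl_lin_linear 1 G X (G * X)))
    (GRing.isMonoidMorphism.Build C B _ fm).
exists F => [|f' f'G f'X u]; first by split; rewrite /= /cl_lin /= !scale0r ?scale1r ?addr0 ?add0r.
have {1}-> : u = cl_1 u *: 1 + cl_G u *: clG + cl_X u *: clX +
                 cl_GX u *: (clG * clX) by rewrite -clE; case: u.
by rewrite !linearD !linearZ rmorphM !rmorph1 /= !f'G !f'X.
Qed.
End Universal.

Lemma cl_linE (V : lmodType k) (f : {linear C -> V}) :
  f =1 cl_lin (f 1) (f clG) (f clX) (f (clG * clX)).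
Proof.
move=> u; have {1}-> : u = cl_1 u *: 1 + cl_G u *: clG + cl_X u *: clX +
                 cl_GX u *: (clG * clX) by rewrite -clE; case: u.
by rewrite !linearD !linearZ.
Qed.

Lemma dim_cl : \dim {:C} = 4.
Proof. by rewrite dimvf. Qed.

Lemma cl_free : free [:: 1; clG; clX; clG * clX].
Proof.
apply/freeP => c; rewrite !big_ord_recl big_ord0 /= addr0 !addrA -clE.
case=> c0 c1 c2 c3 -[[|[|[|[|]]]] i4] //.
- by rewrite -c0; congr c; apply/val_inj.
- by rewrite -c1; congr c; apply/val_inj.
- by rewrite -c2; congr c; apply/val_inj.
- by rewrite -c3; congr c; apply/val_inj.
Qed.

End Clifford.

Arguments clG {k al be ga}.
Arguments clX {k al be ga}.

(** As an algebra, H_4 = Cl(1,0,0). *)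
Definition H4_alg (k : fieldType) : falgType k := Cl (1 : k) 0 0.

Section Sweedler.
Variable k : fieldType.
Notation H := (H4_alg k).

Definition H4g : H := clG.
Definition H4x : H := clX.

(** The value at gx is that of the algebra morphism: Δ(gx) = Δ(g)Δ(x) here,
    S(gx) = S(x)S(g) = -x below; similarly for [cl_coact]. *)
Definition H4_comul : {linear H -> tensor H H} :=
  cl_lin (1 ⊗ 1) (H4g ⊗ H4g) (H4x ⊗ H4g + 1 ⊗ H4x)
    (tmul (H4g ⊗ H4g) (H4x ⊗ H4g + 1 ⊗ H4x)).
Definition H4_counit : {linear H -> k^o} := cl_lin (1 : k^o) 1 0 0.
Definition H4_antipode : {linear H -> H} :=
  cl_lin 1 H4g (H4g * H4x) ((H4g * H4x) * H4g).
Definition H4_antipode_inv : {linear H -> H} :=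
  cl_lin 1 H4g (- (H4g * H4x)) H4x.

Definition cl_coact (al be ga : k) :
    {linear Cl al be ga -> tensor (Cl al be ga) H} :=
  cl_lin (1 ⊗ 1) (clG ⊗ H4g) (clX ⊗ H4g + 1 ⊗ H4x)
    (tmul (clG ⊗ H4g) (clX ⊗ H4g + 1 ⊗ H4x)).

(** Every element of V ⊗ H_4 is uniquely of this form; the definition is locked
    because rewriting is slow otherwise. *)
Fact nf_key : unit. Proof. exact: tt. Qed.
Definition nf (V : vectType k) (p0 p1 p2 p3 : V) : tensor V H := locked_with nf_key
  (p0 ⊗ 1 + p1 ⊗ H4g + p2 ⊗ H4x + p3 ⊗ (H4g * H4x)).

Lemma nfE (V : vectType k) (p0 p1 p2 p3 : V) :
  nf p0 p1 p2 p3 = p0 ⊗ 1 + p1 ⊗ H4g + p2 ⊗ H4x + p3 ⊗ (H4g * H4x).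
Proof. by rewrite /nf unlock. Qed.

Lemma eq_nf (V : vectType k) (p0 p1 p2 p3 q0 q1 q2 q3 : V) :
  p0 = q0 -> p1 = q1 -> p2 = q2 -> p3 = q3 -> nf p0 p1 p2 p3 = nf q0 q1 q2 q3.
Proof. by move=> -> -> -> ->. Qed.

Lemma nfD (V : vectType k) (p0 p1 p2 p3 q0 q1 q2 q3 : V) :
  nf p0 p1 p2 p3 + nf q0 q1 q2 q3 = nf (p0 + q0) (p1 + q1) (p2 + q2) (p3 + q3).
Proof.
rewrite !nfE !tensDl.
by rewrite (AC (4*4) ((1*5)*(2*6)*(3*7)*(4*8))).
Qed.

Lemma nfZ (V : vectType k) e (p0 p1 p2 p3 : V) :
  e *: nf p0 p1 p2 p3 = nf (e *: p0) (e *: p1) (e *: p2) (e *: p3).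
Proof. by rewrite !nfE !tensZl !scalerDr. Qed.

Lemma tens0l (V W : vectType k) (w : W) : (0 : V) ⊗ w = 0.
Proof. by rewrite -(scale0r (0 : V)) tensZl scale0r. Qed.

Lemma tens_nf (V : vectType k) (v : V) (h : H) :
  v ⊗ h = nf (cl_1 h *: v) (cl_G h *: v) (cl_X h *: v) (cl_GX h *: v).
Proof.
have {1}-> : h = cl_1 h *: 1 + cl_G h *: H4g + cl_X h *: H4x +
                 cl_GX h *: (H4g * H4x) by rewrite -clE; case: h.
by rewrite !tensDr !tensZr nfE !tensZl.
Qed.

Lemma sw_nf (V : vectType k) (U : lmodType k) (p0 p1 p2 p3 : V)
    (f : V -> H -> U) :
    (forall w, linear (f^~ w)) -> (forall v, linear (f v)) ->
  sw (nf p0 p1 p2 p3) f = f p0 1 + f p1 H4g + f p2 H4x + f p3 (H4g * H4x).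
Proof. by move=> fl fr; rewrite nfE !swD !sw_tens. Qed.

Lemma tmulDl (A B : falgType k) (s s' t : tensor A B) :
  tmul (s + s') t = tmul s t + tmul s' t.
Proof. by rewrite /tmul swD. Qed.

Lemma tmulDr (A B : falgType k) (s t t' : tensor A B) :
  tmul s (t + t') = tmul s t + tmul s t'.
Proof. by rewrite -[t]scale1r (@tmul_linearr _ _ _ s) !scale1r. Qed.

End Sweedler.

Section CoactTheory.
Variable (k : fieldType).
Notation H := (H4_alg k).

Lemma sw_bilin_tens (V W U : vectType k) (t : tensor V W) (w : U) :
  sw t (fun b c => b ⊗ c ⊗ w) = t ⊗ w.
Proof.
have E : sw t (fun b c => b ⊗ c) = t.
  apply/matrixP => i j; rewrite summxE (bigD1 i) //= summxE (bigD1 j) //=.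
  have cb (X : vectType k) (a b : 'I_(\dim {:X})) :
    coord (vbasis {:X}) a (vbasis {:X})`_b = (b == a)%:R.
    by rewrite coord_free // (basis_free (vbasisP _)).
  rewrite !mxE !cb !eqxx !mulr1 !big1 ?addr0 // => [i' ne | j' ne].
    by rewrite summxE big1 // => j' _; rewrite !mxE !cb (negPf ne) mul0r mulr0.
  by rewrite !mxE !cb (negPf ne) !mulr0.
rewrite -[in RHS]E /sw.
have tens_sum n (F : 'I_n -> tensor V W) :
    (\sum_i F i) ⊗ w = \sum_i F i ⊗ w.
  by apply: (big_morph (fun s => s ⊗ w)) => [s s'|]; rewrite ?tensDl ?tens0l.
rewrite tens_sum; apply: eq_bigr => i _; rewrite tens_sum; apply: eq_bigr => j _.
by rewrite tensZl.
Qed.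

Variables (al be ga : k).
Notation C := (Cl al be ga).

Lemma cl_coactE (u : C) : cl_coact al be ga u =
  nf (cl al be ga (cl_1 u) 0 0 (cl_GX u)) (cl al be ga 0 (cl_G u) (cl_X u) 0)
     (cl al be ga (cl_X u) 0 0 0) (cl al be ga 0 (cl_GX u) 0 0).
Proof.
transitivity (cl_1 u *: (1 ⊗ 1) + cl_G u *: (clG ⊗ H4g k) +
  cl_X u *: (clX ⊗ H4g k + 1 ⊗ H4x k) +
  cl_GX u *: (tmul (clG ⊗ H4g k) (clX ⊗ H4g k + 1 ⊗ H4x k)) : tensor C H).
  by [].
rewrite tmulDr !tmul_tens !tens_nf !nfD !nfZ !nfD.
by apply: eq_nf; apply: cl_ext; cbn; ring.
Qed.
End CoactTheory.

Ltac cl_solve := apply: cl_ext; cbn; ring.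

Section Sw2.
Variables (k : fieldType).
Notation H := (H4_alg k).

Lemma H4_comulE (h : H) : H4_comul k h =
  nf (cl 1 0 0 (cl_1 h) 0 0 (cl_GX h) : H) (cl 1 0 0 0 (cl_G h) (cl_X h) 0)
     (cl 1 0 0 (cl_X h) 0 0 0) (cl 1 0 0 0 (cl_GX h) 0 0).
Proof. exact: (cl_coactE (h : Cl (1 : k) 0 0)). Qed.

Lemma H4_comul_basis :
  (H4_comul k 1 = 1 ⊗ 1) * (H4_comul k (H4g k) = H4g k ⊗ H4g k) *
  (H4_comul k (H4x k) = H4x k ⊗ H4g k + 1 ⊗ H4x k) *
  (H4_comul k (H4g k * H4x k) = (H4g k * H4x k) ⊗ 1 + H4g k ⊗ (H4g k * H4x k)).
Proof.
do !split; rewrite H4_comulE !tens_nf ?nfD; apply: eq_nf; cl_solve.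
Qed.

Lemma sw_nf1 (V : vectType k) (U : lmodType k) (f : {linear V -> U})
  (p0 p1 p2 p3 : V) (e : {linear H -> k^o}) :
  sw (nf p0 p1 p2 p3) (fun v h => e h *: f v) =
  e 1 *: f p0 + e (H4g k) *: f p1 + e (H4x k) *: f p2 + e (H4g k * H4x k) *: f p3.
Proof.
rewrite sw_nf // => [w | v] c x y /=.
  by rewrite linearP scalerDr !scalerA mulrC.
by rewrite linearP scalerDl scalerA.
Qed.

Lemma H4_counitE (h : H) : H4_counit k h = cl_1 h + cl_G h.
Proof.
transitivity (cl_1 h * 1 + cl_G h * 1 + cl_X h * 0 + cl_GX h * 0); first by [].
by rewrite !mulr1 !mulr0 !addr0.
Qed.

Variables (al be ga : k).
Notation C := (Cl al be ga).
Notation coact := (cl_coact al be ga).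

Lemma cl_coactA (a : C) :
    sw (coact a) (fun a0 a1 => sw (coact a0) (fun b c => b ⊗ c ⊗ a1)) =
    sw (coact a) (fun a0 a1 => sw (H4_comul k a1) (fun b c => a0 ⊗ b ⊗ c)).
Proof.
rewrite [LHS](eq_sw _ (f' := fun a0 a1 => coact a0 ⊗ a1)); last first.
  by move=> v w; rewrite sw_bilin_tens.
rewrite cl_coactE !sw_nf; first last.
- by move=> v c x y; rewrite tensDr tensZr.
- by move=> w c x y; rewrite linearP tensDl tensZl.
- by move=> v c x y; rewrite linearP swD swZ.
- by move=> w; apply: sw_linear => u v c x y; rewrite !tensDl !tensZl.
rewrite !H4_comul_basis !swD !sw_tens; try by move=> v c x y; rewrite !(tensDr, tensZr, tensDl, tensZl).
rewrite -nfE !cl_coactE !tens_nf !nfZ !nfD.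
by do !apply: eq_nf; cl_solve.
Qed.

Lemma cl_coact_counit (a : C) :
  sw (coact a) (fun a0 a1 => H4_counit k a1 *: a0) = a.
Proof.
rewrite cl_coactE (sw_nf1 idfun) !H4_counitE; cl_solve.
Qed.

Lemma cl_coact1 : coact 1 = 1 ⊗ 1.
Proof. by rewrite cl_coactE tens_nf; apply: eq_nf; cl_solve. Qed.

Lemma cl_coactM (a b : C) : coact (a * b) = tmul (coact a) (coact b).
Proof.
rewrite !cl_coactE [in RHS]nfE [X in tmul _ X]nfE.
rewrite !(tmulDl, tmulDr) !tmul_tens !tens_nf !nfD.
by case: a b => a0 a1 a2 a3 [b0 b1 b2 b3]; apply: eq_nf; cl_solve.
Qed.

Lemma H4_antipodeE (h : H) :
  H4_antipode k h = cl 1 0 0 (cl_1 h) (cl_G h) (- cl_GX h) (cl_X h).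
Proof.
transitivity (cl_1 h *: 1 + cl_G h *: H4g k + cl_X h *: (H4g k * H4x k) +
  cl_GX h *: (H4g k * H4x k * H4g k)); [by [] | cl_solve].
Qed.

Lemma H4_antipode_invE (h : H) :
  H4_antipode_inv k h = cl 1 0 0 (cl_1 h) (cl_G h) (cl_GX h) (- cl_X h).
Proof.
transitivity (cl_1 h *: 1 + cl_G h *: H4g k + cl_X h *: (- (H4g k * H4x k)) +
  cl_GX h *: H4x k); [by [] | cl_solve].
Qed.

Lemma H4_antipodel (h : H) :
  sw (H4_comul k h) (fun h1 h2 => H4_antipode k h1 * h2) = H4_counit k h *: 1.
Proof.
rewrite H4_comulE sw_nf ?H4_counitE ?H4_antipodeE; first by cl_solve.
- by move=> w c x y; rewrite linearP mulrDl scalerAl.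
- by move=> v c x y; rewrite mulrDr scalerAr.
Qed.

Lemma H4_antipoder (h : H) :
  sw (H4_comul k h) (fun h1 h2 => h1 * H4_antipode k h2) = H4_counit k h *: 1.
Proof.
rewrite H4_comulE sw_nf ?H4_counitE ?H4_antipodeE; first by cl_solve.
- by move=> w c x y; rewrite mulrDl scalerAl.
- by move=> v c x y; rewrite linearP mulrDr scalerAr.
Qed.

Lemma H4_counitl (h : H) :
  sw (H4_comul k h) (fun h1 h2 => H4_counit k h1 *: h2) = h.
Proof.
rewrite H4_comulE sw_nf ?H4_counitE; first by cl_solve.
- by move=> w c x y; rewrite linearP scalerDl scalerA.
- by move=> v c x y; rewrite scalerDr !scalerA mulrC.
Qed.

Lemma H4_counitM (h h' : H) :
  H4_counit k (h * h') = H4_counit k h * H4_counit k h'.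
Proof. by case: h h' => a b c d [a' b' c' d']; rewrite !H4_counitE; cbn; ring. Qed.

End Sw2.


Section H4Hopf.
Variable k : fieldType.
Notation H := (H4_alg k).

Lemma H4_antipodeK : cancel (H4_antipode k) (H4_antipode_inv k).
Proof. by move=> h; rewrite H4_antipode_invE H4_antipodeE; cl_solve. Qed.

Lemma H4_antipode_invK : cancel (H4_antipode_inv k) (H4_antipode k).
Proof. by move=> h; rewrite H4_antipode_invE H4_antipodeE; cl_solve. Qed.

Lemma H4_counit1 : H4_counit k 1 = 1.
Proof. by rewrite H4_counitE; cbn; ring. Qed.

Definition H4 : hopfAlgebra k :=
  @HopfAlgebra k H (H4_comul k) (H4_counit k) (H4_antipode k)
    (H4_antipode_inv k) (@cl_coactA k 1 0 0) (@H4_counitl k)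
    (@cl_coact_counit k 1 0 0) (@cl_coact1 k 1 0 0) (@cl_coactM k 1 0 0)
    H4_counit1 (@H4_counitM k) (@H4_antipodel k) (@H4_antipoder k)
    H4_antipodeK H4_antipode_invK.

(** Cl(α,β,γ) with its canonical H_4-comodule algebra structure. *)
Definition ClComod (al be ga : k) : comoduleAlgebra H4 :=
  @ComoduleAlgebra k H4 (Cl al be ga) (cl_coact al be ga)
    (@cl_coactA k al be ga) (@cl_coact_counit k al be ga)
    (@cl_coact1 k al be ga) (@cl_coactM k al be ga).
End H4Hopf.

Definition total_integral_params (k : fieldType) (al be ga : k)
    (T : {linear H4 k -> tensor (ClComod al be ga) (H4 k)})
    (A B C D E Z : k) : Prop :=
  let one : ClComod al be ga := 1 in
  let G : ClComod al be ga := clG in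
  let X : ClComod al be ga := clX in
  let oneH : H4 k := 1 in
  let g : H4 k := H4g k in
  let x : H4 k := H4x k in
  [/\ T g = A *: (one ⊗ g) + B *: (G ⊗ oneH) + Z *: ((G * X) ⊗ g)
            - Z *: (G ⊗ (g * x)),
      T x = (- (ga / 2 * B)) *: (one ⊗ oneH) + B *: ((G * X) ⊗ oneH)
            + (be * Z) *: (G ⊗ g) - A *: (one ⊗ (g * x))
            - Z *: ((G * X) ⊗ (g * x)),
      T (g * x) = D *: (one ⊗ x) + (ga / 2 * E) *: (one ⊗ g)
            - C *: (G ⊗ oneH) + (D - 1) *: (X ⊗ oneH)
            - E *: ((G * X) ⊗ g) + E *: (G ⊗ (g * x)) &
      [/\ Z * al = 0, Z * ga = 0, (D - 1) * ga - 2 * C * al = 0 &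
          2 * (D - 1) * be - C * ga = 0]].

(* Main.v *)
(** Since ε is an algebra map, so is Id ⊗ ε; hence the h-property says exactly
  that t := (Id ⊗ ε) T : H_4 -> Cl(α,β,γ) reverses products.  From t(g)^2 = 1 one
  gets AB = AZ = 0 and A^2 + αB^2 = 1, so Z = 0 because Zα = 0; and then
  t(x) t(g) = t(gx) expresses C, D and E through A and B.  If B = 0 this gives
  A = ±1; if A = 0 it gives αB^2 = 1, and the constraint 2(D-1)β = Cγ becomes
  γ^2 = 4αβ, which is what t(x)^2 = 0 needs. *)

Require Import Defs.
From mathcomp Require Import all_boot all_order all_algebra falgebra.
From mathcomp Require Import ring.

Set Implicit Arguments.
Unset Strict Implicit.

Import GRing.Theory.
Local Open Scope ring_scope.

(** Linearity is a hypothesis on a bare function, so that the lemma covers [id_counit] as well as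
    left and right multiplications. *)
Lemma linear_sw (k : fieldType) (V W : vectType k) (U U' : lmodType k)
    (phi : U -> U') (t : tensor V W) (f : V -> W -> U) :
  linear phi -> phi (sw t f) = sw t (fun v w => phi (f v w)).
Proof.
move=> phi_lin.
have phiD : {morph phi : u v / u + v}.
  by move=> u v; have := phi_lin 1 u v; rewrite !scale1r.
have phi0 := linear_fun0 phi_lin.
rewrite /sw (big_morph phi phiD phi0); apply: eq_bigr => i _.
rewrite (big_morph phi phiD phi0); apply: eq_bigr => j _.
by rewrite -[X in phi X]addr0 phi_lin phi0 addr0.
Qed.

Lemma neq0_of_mul_sqr_eq1 (k : fieldType) (a b : k) :
  a * b ^+ 2 = 1 -> a != 0 /\ b != 0.
Proof.
move=> ab1; have : a * b ^+ 2 != 0 by rewrite ab1 oner_neq0.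
by rewrite mulf_eq0 expf_eq0 negb_or => /andP[].
Qed.

(** * Multiplicativity of Id ⊗ ε *)

Section IdCounit.
Variables (k : fieldType) (H : hopfAlgebra k) (A : comoduleAlgebra H).

Lemma id_counit_linear : linear (@id_counit k H A).
Proof. by move=> c s t; rewrite /id_counit swD swZ. Qed.

Lemma id_counit_tens (a : A) (h : H) : id_counit (a ⊗ h) = counit H h *: a.
Proof.
rewrite /id_counit sw_tens // => [w | v] c x y.
  by rewrite scalerDr !scalerA mulrC.
by rewrite linearP scalerDl scalerA.
Qed.

(** By linearity [id_counit] passes under both sums of [tmul]; on pure tensors the claim is
    [counitM]. *)
Lemma id_counitM (s t : tensor A H) :
  id_counit (tmul s t) = id_counit s * id_counit t.
Proof.
have inner (a : A) (b : H) :
    id_counit (sw t (fun a' b' => (a * a') ⊗ (b * b'))) =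
    (counit H b *: a) * id_counit t.
  apply: (etrans (linear_sw _ _ id_counit_linear)).
  rewrite [in RHS]/id_counit [RHS]linear_sw; last first.
    by move=> c x y; rewrite mulrDr scalerAr.
  apply: eq_sw => a' b'.
  by rewrite id_counit_tens counitM -scalerAl -scalerAr scalerA.
apply: (etrans (linear_sw _ _ id_counit_linear)).
rewrite [X in _ = X * _]/id_counit [RHS](@linear_sw _ _ _ _ _ (fun u => u * _)).
  exact: eq_sw.
by move=> c x y; rewrite mulrDl scalerAl.
Qed.

Lemma h_propertyE (T : {linear H -> tensor A H}) :
  h_property T <->
  forall h h' : H, id_counit (T h) * id_counit (T h') = id_counit (T (h' * h)).
Proof. by split=> + h h' => /(_ h h'); rewrite id_counitM. Qed.

End IdCounit.

(** Each linear form e on H_4 induces a map Id ⊗ e on V ⊗ H_4; the four coordinate forms recover the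
    four entries. *)
Lemma nf_inj (k : fieldType) (V : vectType k) (p0 p1 p2 p3 q0 q1 q2 q3 : V) :
  nf p0 p1 p2 p3 = nf q0 q1 q2 q3 -> [/\ p0 = q0, p1 = q1, p2 = q2 & p3 = q3].
Proof.
move=> pq.
have coeff (c0 c1 c2 c3 : k) :
    c0 *: p0 + c1 *: p1 + c2 *: p2 + c3 *: p3 =
    c0 *: q0 + c1 *: q1 + c2 *: q2 + c3 *: q3.
  pose e : {linear H4_alg k -> k^o} :=
    cl_lin (c0 : k^o) (c1 : k^o) (c2 : k^o) (c3 : k^o).
  have eE h : e h = cl_1 h * c0 + cl_G h * c1 + cl_X h * c2 + cl_GX h * c3.
    by [].
  have := congr1 (fun t => sw t (fun v h => e h *: idfun v)) pq.
  rewrite !(sw_nf1 (V:=V) idfun) !eE /H4g /H4x clGXE /=.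
  by rewrite !(mul1r, mul0r, addr0, add0r).
split; [have := coeff 1 0 0 0 | have := coeff 0 1 0 0 |
  have := coeff 0 0 1 0 | have := coeff 0 0 0 1];
  by rewrite !scale0r !scale1r !(addr0, add0r).
Qed.

(** * Total integrals in coordinates and necessary conditions on the parameters *)

Section TotalIntegral.
Variables (k : fieldType) (al be ga : k).
Variable T : {linear H4 k -> tensor (ClComod al be ga) (H4 k)}.
Variables (A B C D E Z : k).
Hypothesis T_unit : T 1 = (1 : ClComod al be ga) ⊗ (1 : H4 k).
Hypothesis T_params : total_integral_params T A B C D E Z.

Local Notation clA := (cl al be ga).

Lemma total_integral_nf1 : T 1 =
  nf (clA 1 0 0 0) (clA 0 0 0 0) (clA 0 0 0 0) (clA 0 0 0 0).
Proof. by rewrite T_unit tens_nf; apply: eq_nf; cl_solve. Qed.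

Lemma total_integral_nf_g : T (H4g k) =
  nf (clA 0 B 0 0) (clA A 0 0 Z) (clA 0 0 0 0) (clA 0 (- Z) 0 0).
Proof.
case: T_params => -> _ _ _; rewrite -!scaleNr !tens_nf !nfZ !nfD.
by apply: eq_nf; cl_solve.
Qed.

Lemma total_integral_nf_x : T (H4x k) =
  nf (clA (- (ga / 2 * B)) 0 0 B) (clA 0 (be * Z) 0 0) (clA 0 0 0 0)
    (clA (- A) 0 0 (- Z)).
Proof.
case: T_params => _ -> _ _; rewrite -!scaleNr !tens_nf !nfZ !nfD.
by apply: eq_nf; cl_solve.
Qed.

Lemma total_integral_nf_gx : T (H4g k * H4x k) =
  nf (clA 0 (- C) (D - 1) 0) (clA (ga / 2 * E) 0 0 (- E)) (clA D 0 0 0)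
    (clA 0 E 0 0).
Proof.
case: T_params => _ _ -> _; rewrite -!scaleNr !tens_nf !nfZ !nfD.
by apply: eq_nf; cl_solve.
Qed.

(** Only two entries survive, since ε is 1 on 1 and g and 0 on x and gx. *)
Lemma id_counit_nf (p0 p1 p2 p3 : ClComod al be ga) :
  id_counit (nf p0 p1 p2 p3 : tensor (ClComod al be ga) (H4 k)) = p0 + p1.
Proof.
rewrite /id_counit (sw_nf1 idfun) !H4_counitE /H4g /H4x clGXE.
by rewrite !(addr0, add0r, scale1r, scale0r).
Qed.

(** This is the map t = (Id ⊗ ε)T in coordinates; it turns the h-property into polynomial identities
    in the parameters. *)
Lemma id_counit_total_integral (h : H4 k) : id_counit (T h) =
  clA (cl_1 h + cl_G h * A - cl_X h * (ga / 2 * B) + cl_GX h * (ga / 2 * E))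
      (cl_G h * B + cl_X h * (be * Z) - cl_GX h * C)
      (cl_GX h * (D - 1))
      (cl_G h * Z + cl_X h * B - cl_GX h * E).
Proof.
have -> : T h = cl_1 h *: T 1 + cl_G h *: T (H4g k) + cl_X h *: T (H4x k) +
    cl_GX h *: T (H4g k * H4x k) by exact: cl_linE.
rewrite total_integral_nf1 total_integral_nf_g total_integral_nf_x.
rewrite total_integral_nf_gx !nfZ !nfD id_counit_nf.
by cl_solve.
Qed.

(** Two instances of the h-property suffice: the pair (g, g) and the pair (x, g). *)
Lemma h_property_params : (2 : k) != 0 -> h_property T ->
  [/\ A * B = 0, A ^+ 2 + al * B ^+ 2 = 1, C = - (ga / 2 * B ^+ 2) &
      [/\ D = 1 - al * B ^+ 2, E = 0 & Z = 0]].
Proof.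
move=> two_neq0 /h_propertyE T_h.
case: T_params => _ _ _ [Zal Zga _ _].
(* Here t(g) = A + BG + Z GX, whose square has coefficients A^2 + αB^2 - αβZ^2 at 1, 2AB + γZB at G
   and 2AZ + γZ^2 at GX. The relations Zα = Zγ = 0 remove the extra terms. *)
have := T_h (H4g k) (H4g k); rewrite !id_counit_total_integral clM; cbn.
case=> gg0 gg1 _ gg3.
have AB : A * B = 0.
  apply: (mulfI two_neq0); transitivity (2 * (A * B) + (Z * ga) * B).
    by rewrite Zga; ring.
  by apply: etrans (etrans _ gg1) _; ring.
have AZ : A * Z = 0.
  apply: (mulfI two_neq0); transitivity (2 * (A * Z) + (Z * ga) * Z).
    by rewrite Zga; ring.
  by apply: etrans (etrans _ gg3) _; ring.
have AB1 : A ^+ 2 + al * B ^+ 2 = 1.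
  transitivity (A ^+ 2 + al * B ^+ 2 - be * (Z * al) * Z).
    by rewrite Zal; ring.
  by apply: etrans (etrans _ gg0) _; ring.
have Z0 : Z = 0.
  transitivity (Z * (A ^+ 2 + al * B ^+ 2)); first by rewrite AB1 mulr1.
  by transitivity (A * (A * Z) + Z * al * B ^+ 2); [ring | rewrite AZ Zal; ring].
(* In t(x)t(g) = t(gx), the coefficients at G, X and GX determine C, D and E respectively. *)
have := T_h (H4x k) (H4g k); rewrite !id_counit_total_integral clM Z0; cbn.
case=> _ xg1 xg2 xg3; split=> //.
  have -> : C = - (- C) by ring.
  congr (- _); apply: etrans (etrans _ (esym xg1)) _; first by ring.
  by field.
split=> //.
  apply: (addIr (-1)); apply: etrans (etrans _ (esym xg2)) _; ring.
apply: oppr_inj; rewrite oppr0 -AB.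
by apply: etrans (etrans _ (esym xg3)) _; ring.
Qed.

End TotalIntegral.

Theorem theorem5p2 (k : fieldType) (char_k : 2%N \notin [pchar k])
    (al be ga : k)
    (T : {linear H4 k -> tensor (ClComod al be ga) (H4 k)})
    (A B C D E Z : k)
    (T_total : is_total_integral T)
    (T_params : total_integral_params T A B C D E Z) :
  (h_property T <->
     [\/ [/\ A = 1, B = 0, C = 0 & [/\ D = 1, E = 0 & Z = 0]],
         [/\ A = -1, B = 0, C = 0 & [/\ D = 1, E = 0 & Z = 0]] |
         [/\ ga ^+ 2 - 4 * al * be = 0, exists2 s : k, s != 0 & al = s ^+ 2 &
             [/\ A = 0, al * B ^+ 2 = 1, C = - (ga / (2 * al)) &
                 [/\ D = 0, E = 0 & Z = 0]]]])
  /\ ([/\ A = 1, B = 0, C = 0 & [/\ D = 1, E = 0 & Z = 0]] <->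
      forall h : H4 k, T h = (1 : ClComod al be ga) ⊗ antipode_inv (H4 k) h).
Proof.
have two_neq0 : (2 : k) != 0 by apply: contra char_k => ?; rewrite inE.
case: T_total => _ T1; split.
  split=> [T_h | params].
    have [AB AB1 CE [DE E0 Z0]] := h_property_params T1 T_params two_neq0 T_h.
    (* The branch A = 0 leads to case 3, the branch B = 0 to cases 1 and 2. *)
    have /eqP := AB; rewrite mulf_eq0 => /orP[] /eqP X0.
      have alB : al * B ^+ 2 = 1 by rewrite -AB1 X0; ring.
      have [al0 B0] := neq0_of_mul_sqr_eq1 alB.
      have BE : B ^+ 2 = al^-1 by rewrite -[RHS]mulr1 -alB mulKf.
      have D0 : D = 0 by rewrite DE alB subrr.
      have C_al : C = - (ga / (2 * al)) by rewrite CE BE invfM mulrA.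
      apply: Or33; split=> //.
        case: T_params => _ _ _ [_ _ _]; rewrite D0 C_al => disc.
        (* Multiplying the constraint 2(D-1)β - Cγ = 0 by 2α clears the denominator of C and leaves
           γ^2 - 4αβ. *)
        transitivity ((2 * al) * (2 * (0 - 1) * be - - (ga / (2 * al)) * ga)).
          by field; rewrite al0 two_neq0.
        by rewrite disc mulr0.
      exists B^-1; first by rewrite invr_eq0.
      by rewrite exprVn BE invrK.
    have C0 : C = 0 by rewrite CE X0; ring.
    have D1 : D = 1 by rewrite DE X0; ring.
    have /eqP : A ^+ 2 = 1 by rewrite -AB1 X0; ring.
    by rewrite sqrf_eq1 => /orP[] /eqP A1; [apply: Or31 | apply: Or32].
  (* Conversely, t(h)t(h') = t(h'h) is checked in coordinates for arbitrary h and h'. *)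
  apply/h_propertyE => -[a b c d] [a' b' c' d'].
  rewrite !(id_counit_total_integral T1 T_params) !clM; cbn.
  case: params => [[-> -> -> [-> -> ->]]|[-> -> -> [-> -> ->]]|].
  - by apply: cl_ext; cbn; ring.
  - by apply: cl_ext; cbn; ring.
  case=> disc _ [-> alB -> [-> -> ->]].
  have [al0 B0] := neq0_of_mul_sqr_eq1 alB.
  (* Case 3 is parametrised by B and γ alone: αB^2 = 1 gives α, and the vanishing discriminant then
     gives β. The identities become rational in B and γ. *)
  have al_E : al = B ^- 2.
    by apply: (mulIf (expf_neq0 2 B0)); rewrite alB mulVf ?expf_neq0.
  have four_neq0 : (4 : k) != 0.
    have -> : (4 : k) = 2 * 2 by ring.
    by rewrite mulf_neq0.
  have be_E : be = (ga / 2 * B) ^+ 2.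
    apply: (mulfI al0); transitivity ((ga ^+ 2 - (ga ^+ 2 - 4 * al * be)) / 4).
      by field.
    rewrite disc al_E; field.
    by rewrite two_neq0 B0.
  by apply: cl_ext; cbn; rewrite be_E al_E; field; rewrite B0 two_neq0.
split=> [[A1 B0 C0 [D1 E0 Z0]] h | T_S].
  have -> : T h = cl_1 h *: T 1 + cl_G h *: T (H4g k) + cl_X h *: T (H4x k) +
      cl_GX h *: T (H4g k * H4x k) by exact: cl_linE.
  rewrite (total_integral_nf1 T1) (total_integral_nf_g T_params).
  rewrite (total_integral_nf_x T_params) (total_integral_nf_gx T_params).
  rewrite A1 B0 C0 D1 E0 Z0 !nfZ !nfD tens_nf H4_antipode_invE.
  by apply: eq_nf; cl_solve.
(* The value at g determines A, B and Z, and the value at gx determines C, D and E. *)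
have := T_S (H4g k); rewrite (total_integral_nf_g T_params) tens_nf.
rewrite H4_antipode_invE => /nf_inj[g0 g1 _ _].
have := T_S (H4g k * H4x k); rewrite (total_integral_nf_gx T_params) tens_nf.
rewrite H4_antipode_invE => /nf_inj[gx0 gx1 gx2 _].
have := congr1 (@cl_1 _ _ _ _) g1; have := congr1 (@cl_GX _ _ _ _) g1.
have := congr1 (@cl_G _ _ _ _) g0; have := congr1 (@cl_G _ _ _ _) gx0.
have := congr1 (@cl_GX _ _ _ _) gx1; have := congr1 (@cl_1 _ _ _ _) gx2.
cbn=> D1 E0 C0 B0 Z0 A1.
split; [by rewrite A1; ring | by rewrite B0; ring | | split].
- by apply: oppr_inj; rewrite C0; ring.
- by rewrite D1; ring.
- by apply: oppr_inj; rewrite E0; ring.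
- by rewrite Z0; ring.
Qed.
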